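(* Let $2\le a\le b$ be integers with $g=\gcd(a,b)$, and let $j$ be an integer with $1\le j\le g-2$. Then there exists an ideal $I\in\mathcal I^1_{a,b}$ such that $c(I)=j$.
   Context: $K$ is a field. $\mathcal I^1_{a,b}$ is the set of monomial ideals $I\subset K[x,y]$ having $x^a,y^b$ among their minimal monomial generators and all of whose minimal monomial generators $x^cy^d$ satisfy $bc+ad=ab$. For $L\in\mathcal I^1_{a,b}$ the reduction number $r(L)$ is the smallest integer $r\ge0$ with $L^{r+1}=(x^a,y^b)L^r$ (such $r$ exists). If $I\in\mathcal I^1_{a,b}$ then $I^k\in\mathcal I^1_{ka,kb}$ for $k\ge1$, so $r(I^k)$ is the reduction number of $I^k$ with respect to $(x^{ka},y^{kb})$. For $I\in\mathcal I^1_{a,b}$, $c(I)=\inf\{k\ge1 : r(I^k)=1\}$. *)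

(* Defs.v *)
From mathcomp Require Import all_boot all_algebra.
From mathcomp Require Import mpoly.

Set Implicit Arguments.
Unset Strict Implicit.
Unset Printing Implicit Defensive.

Import GRing.Theory.
Local Open Scope ring_scope.

(* Ideals are Prop-valued predicates, because the library's [idealr] only
   covers proper ideals given by boolean predicates and so excludes [L ^ 0],
   the unit ideal, which occurs in the definition of the reduction number.
   Equality of ideals is extensional. *)
Section Ideals.

Variable R : comNzRingType.
Implicit Types (S I J : R -> Prop).

Definition is_ideal I : Prop :=
  [/\ I 0,
      forall u v, I u -> I v -> I (u + v)
    & forall p u, I u -> I (p * u)].

Definition ideal_eq I J : Prop := forall u, I u <-> J u.

Definition ideal_gen S : R -> Prop := fun u =>
  exists s : seq (R * R),
    (forall q, q \in s -> S q.2) /\ u = \sum_(q <- s) q.1 * q.2.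

Definition ideal_mul I J : R -> Prop :=
  ideal_gen (fun u => exists v w, [/\ I v, J w & u = v * w]).

Definition ideal_exp I (n : nat) : R -> Prop :=
  iter n (ideal_mul I) (fun=> True).

End Ideals.

Definition least_nat (P : nat -> Prop) (n : nat) : Prop :=
  P n /\ forall m : nat, P m -> (n <= m)%N.

Section MonomialIdeals.

Variable K : fieldType.
Implicit Types (I L : {mpoly K[2]} -> Prop) (G : 'X_{1..2} -> Prop).

(* The variables x and y are ['X_0] and ['X_1]. *)
Definition monom (c d : nat) : 'X_{1..2} := [multinom [tuple c; d]].

Definition monom_gen G : {mpoly K[2]} -> Prop :=
  ideal_gen (fun u => exists m, G m /\ u = 'X_[m]).

Definition monomial_ideal I : Prop :=
  is_ideal I /\ exists G, ideal_eq I (monom_gen G).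

Definition min_monom_gen_set I G : Prop :=
  ideal_eq I (monom_gen G) /\
  forall G', (forall m, G' m -> G m) -> ideal_eq I (monom_gen G') ->
    forall m, G m -> G' m.

(* The generating set [G] is unique for a monomial ideal, so the existential
   quantifier picks out the minimal monomial generators of [I]. *)
Definition min_monom_generator I (m : 'X_{1..2}) : Prop :=
  exists G, min_monom_gen_set I G /\ G m.

Definition ideal_class1 (a b : nat) I : Prop :=
  [/\ monomial_ideal I,
      min_monom_generator I (monom a 0),
      min_monom_generator I (monom 0 b)
    & forall c d : nat, min_monom_generator I (monom c d) ->
        (b * c + a * d = a * b)%N].

Definition corner_ideal (a b : nat) : {mpoly K[2]} -> Prop :=
  monom_gen (fun m => m = monom a 0 \/ m = monom 0 b).

(* [is_reduction_number a b L r] means r(L) = r, for L of class (a, b). *)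
Definition is_reduction_number (a b : nat) L (r : nat) : Prop :=
  least_nat (fun n =>
    ideal_eq (ideal_exp L n.+1) (ideal_mul (corner_ideal a b) (ideal_exp L n)))
    r.

(* [is_c_number a b I j] means c(I) = j. For a finite value [j], the infimum
   of a set of natural numbers equals [j] exactly when [j] is its least
   element; when the set is empty c(I) is infinite and no [j] qualifies. *)
Definition is_c_number (a b : nat) I (j : nat) : Prop :=
  least_nat (fun k =>
    (1 <= k)%N /\ is_reduction_number (k * a) (k * b) (ideal_exp I k) 1) j.

End MonomialIdeals.

(* Main.v *)
Require Import Defs.
From mathcomp Require Import all_boot all_algebra.
From mathcomp Require Import mpoly.
From mathcomp Require Import zify.

(** Write [a = p * g] and [b = q * g].  The monomials on the segment
    [b * c + a * d = a * b] are [x ^ (p * i) * y ^ (q * (g - i))] with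
    [0 <= i <= g], so an ideal of the class is a set [A] of indices containing
    [0] and [g], and multiplying ideals amounts to adding index sets.  No
    monomial of a segment divides another one, hence equality of two such
    ideals is equality of the index sets ([segment_ideal_eqE]).  Thus
    [r(I ^ k) = 1] says that [kA + kA = {0, k * g} + kA] while
    [kA <> {0, k * g}].

    The witness is [A = {0, 1} U [j + 1, g]].  Its [k]-fold sumset is the union
    over [s <= k] of the intervals [[s * (j + 1), s * g + (k - s)]].
    - For [k >= j] these intervals leave no gap, and [kA = [0, k * g]]
      ([full_sumset]).  In particular
      [2jA = [0, 2 * j * g] = {0, j * g} + jA], while [1] belongs to
      [jA] but not to [{0, j * g}]; therefore [r(I ^ j) = 1].
    - For [1 <= k < j] the index [k + 1] lies in the gap of [kA] between the
      intervals [s = 0] and [s = 1].  It is a sum of ones in [2kA], and it is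
      less than [k * g], so it is not in [{0, k * g} + kA]; therefore
      [r(I ^ k) <> 1]. *)

Set Implicit Arguments.
Unset Strict Implicit.
Unset Printing Implicit Defensive.

Import GRing.Theory.

(** * Generated ideals and their products *)

Section GeneratedIdeals.

Local Open Scope ring_scope.

Variable R : comNzRingType.
Implicit Types (S T I J : R -> Prop).

Lemma ideal_eq_sym I J : ideal_eq I J -> ideal_eq J I.
Proof. by move=> h u; split=> /h. Qed.

Lemma ideal_eq_trans I J L : ideal_eq I J -> ideal_eq J L -> ideal_eq I L.
Proof. by move=> h h' u; split=> [/h/h'|/h'/h]. Qed.

Lemma ideal_gen_ideal S : is_ideal (ideal_gen S).
Proof.
split.
- by exists [::]; split=> //; rewrite big_nil.
- move=> u v [s [hs ->]] [t [ht ->]]; exists (s ++ t); split; last by rewrite big_cat.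
  by move=> r; rewrite mem_cat => /orP[/hs|/ht].
- move=> r u [s [hs ->]]; exists [seq (r * z.1, z.2) | z <- s]; split.
    by move=> z /mapP[w /hs hw ->].
  by rewrite big_map mulr_sumr; apply: eq_bigr => z _; rewrite mulrA.
Qed.

Lemma ideal_gen_sub S u : S u -> ideal_gen S u.
Proof.
move=> hu; exists [:: (1, u)]; split; last by rewrite big_seq1 mul1r.
by move=> z; rewrite inE => /eqP->.
Qed.

Lemma ideal_gen_min S J :
  is_ideal J -> (forall u, S u -> J u) -> forall u, ideal_gen S u -> J u.
Proof.
move=> [J0 JD JM] hS u [s [hs ->]]; rewrite big_seq.
by elim/big_ind: _ => // z /hs/hS; apply: JM.
Qed.

Lemma ideal_mul_eq I I' J J' : ideal_eq I I' -> ideal_eq J J' ->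
  ideal_eq (ideal_mul I J) (ideal_mul I' J').
Proof.
move=> hI hJ u; split; (apply: ideal_gen_min; first exact: ideal_gen_ideal);
  move=> _ [v [w [hv hw ->]]]; apply: ideal_gen_sub; exists v, w;
  by split=> //; [apply/hI|apply/hJ].
Qed.

Lemma ideal_exp_eq I J n :
  ideal_eq I J -> ideal_eq (ideal_exp I n) (ideal_exp J n).
Proof. by move=> h; elim: n => // n; apply: ideal_mul_eq. Qed.

Lemma colon_ideal J r : is_ideal J -> is_ideal (fun u => J (r * u)).
Proof.
move=> [J0 JD JM]; split=> [|u v hu hv|t u hu]; first by rewrite mulr0.
  by rewrite mulrDr; apply: JD.
by rewrite mulrCA; apply: JM.
Qed.

(** To show that a product lies in an ideal [J], each factor can be replaced in
    turn by a generator, because the colon of [J] by an element is an ideal. *)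
Lemma ideal_mul_gen S T :
  ideal_eq (ideal_mul (ideal_gen S) (ideal_gen T))
           (ideal_gen (fun u => exists v w, [/\ S v, T w & u = v * w])).
Proof.
set J := (J in ideal_eq _ J); have JI : is_ideal J by exact: ideal_gen_ideal.
move=> u; split; apply: ideal_gen_min; try exact: ideal_gen_ideal.
  move=> _ [v [w [hv hw ->]]]; rewrite mulrC.
  apply: (ideal_gen_min (J := fun z => J (w * z)) (colon_ideal w JI) _ hv).
  move=> v' hv'; rewrite mulrC.
  apply: (ideal_gen_min (J := fun z => J (v' * z)) (colon_ideal v' JI) _ hw).
  move=> w' hw'.
  by apply: ideal_gen_sub; exists v', w'.
move=> _ [v [w [hv hw ->]]]; apply: ideal_gen_sub; exists v, w.
by split=> //; apply: ideal_gen_sub.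
Qed.

End GeneratedIdeals.

(** * Monomial ideals in two variables *)

Section MonomGen.

Local Open Scope ring_scope.

Variable K : fieldType.
Implicit Types (G H : 'X_{1..2} -> Prop) (m : 'X_{1..2}).

Notation mgen := (@monom_gen K).

(** Polynomials all of whose terms are divisible by a member of [G] form an
    ideal, so cancellation in a combination of members of [G] cannot leave a
    monomial that none of them divides. *)
Lemma monom_genP G m : mgen G 'X_[m] <-> exists2 m', G m' & (m' <= m)%MM.
Proof.
split=> [hm|[m' hm' le]]; last first.
  rewrite -(submK le) mpolyXD.
  have [_ _ h] := ideal_gen_ideal (fun u => exists m, G m /\ u = 'X_[m] :> {mpoly K[2]}).
  by apply: h; apply: ideal_gen_sub; exists m'.
pose J (u : {mpoly K[2]}) :=
  forall n, n \in msupp u -> exists2 m', G m' & (m' <= n)%MM.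
have JI : is_ideal J.
  split=> [n|u v hu hv n|r u hu n]; first by rewrite msupp0.
    by move=> /msuppD_le; rewrite mem_cat => /orP[/hu|/hv].
  move=> /msuppM_le/allpairsP[[n1 n2] /= [_ /hu[m' hm' le] ->]].
  by exists m' => //; apply: (lepm_trans le); rewrite lem_addl.
suff /(_ m) : J 'X_[m] by apply; rewrite msuppX mem_head.
apply: ideal_gen_min JI _ _ hm => _ [m' [hm' ->]] n.
by rewrite msuppX inE => /eqP->; exists m'; rewrite ?lepm_refl.
Qed.

Lemma monom_gen_subP G H :
  (forall m, G m -> mgen H 'X_[m]) -> forall u, mgen G u -> mgen H u.
Proof.
by move=> h; apply: ideal_gen_min => [|_ [m [/h hm ->]]] //; apply: ideal_gen_ideal.
Qed.

Lemma monom_gen_sub G m : G m -> mgen G 'X_[m].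
Proof. by move=> hm; apply: ideal_gen_sub; exists m. Qed.

Lemma monom_gen_eq G H :
  (forall m, G m <-> H m) -> ideal_eq (mgen G) (mgen H).
Proof.
by move=> h u; split; apply: monom_gen_subP => m /h; apply: monom_gen_sub.
Qed.

Lemma monom_gen_mul G H :
  ideal_eq (ideal_mul (mgen G) (mgen H))
           (mgen (fun m => exists m1 m2, [/\ G m1, H m2 & m = (m1 + m2)%MM])).
Proof.
apply: ideal_eq_trans (ideal_mul_gen _ _) _ => u; split.
  apply: ideal_gen_min; first exact: ideal_gen_ideal.
  move=> _ [_ [_ [[m1 [h1 ->]] [m2 [h2 ->]] ->]]]; rewrite -mpolyXD.
  by apply: monom_gen_sub; exists m1, m2.
apply: ideal_gen_min; first exact: ideal_gen_ideal.
move=> _ [_ [[m1 [m2 [h1 h2 ->]]] ->]]; apply: ideal_gen_sub.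
by exists 'X_[m1], 'X_[m2]; split; [exists m1|exists m2|rewrite mpolyXD].
Qed.

Lemma monom_gen1 : ideal_eq (mgen (fun m => m = 0%MM)) (fun=> True).
Proof.
move=> u; split=> // _; exists [:: (u, 1)]; split; last by rewrite big_seq1 mulr1.
by move=> z; rewrite inE => /eqP->; exists 0%MM; rewrite mpolyX0.
Qed.

(** Every member of a minimal generating set [G0] divides some member of [G]:
    those that do already generate, since each member of [G] is a multiple of
    a member of [G0].  For an antichain, the divisibility is an equality. *)
Lemma min_monom_generator_antichain G m :
  (forall m1 m2, G m1 -> G m2 -> (m1 <= m2)%MM -> m1 = m2) ->
  min_monom_generator (mgen G) m <-> G m.
Proof.
move=> anti; split; last first.
  move=> hm; exists G; split=> //; split=> // G' sub eqG' n hn.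
  have [/(_ (monom_gen_sub hn))/monom_genP[n' hn' le] _] := eqG' 'X_[n].
  by rewrite -(anti n' n (sub _ hn') hn le).
move=> [G0 [[eqG0 min0] G0m]].
pose G' n := G0 n /\ exists2 n', G n' & (n <= n')%MM.
have [|u|_ [n hn le]] := min0 G' _ _ m G0m; first by move=> n [].
  split; last by move=> hu; apply/eqG0; apply: monom_gen_subP hu => n [/monom_gen_sub].
  apply: monom_gen_subP => n hn; apply/monom_genP.
  have /eqG0/monom_genP[n0 hn0 le] := monom_gen_sub hn.
  by exists n0 => //; split=> //; exists n.
have /eqG0/monom_genP[n1 hn1 le1] := monom_gen_sub G0m.
have e : n1 = n by apply: anti => //; apply: lepm_trans le1 le.
suff -> : m = n by [].
apply/mnmP => i; apply/eqP; rewrite eqn_leq; move/mnm_lepP: le => -> /=.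
by move/mnm_lepP: le1 => /(_ i); rewrite e.
Qed.

End MonomGen.

Lemma monomD c d c' d' :
  (monom c d + monom c' d')%MM = monom (c + c') (d + d').
Proof.
apply/mnmP => i; rewrite mnmDE !multinomE !(tnth_nth 0) /=.
by case: i => [[|[]]].
Qed.

Lemma monom_le c d c' d' :
  (monom c d <= monom c' d')%MM = (c <= c')%N && (d <= d')%N.
Proof.
apply/mnm_lepP/andP => [h|[h1 h2] i].
  by split; [have := h ord0|have := h ord_max];
    rewrite !multinomE !(tnth_nth 0).
by rewrite !multinomE !(tnth_nth 0); case: i => [[|[]]].
Qed.

(** * Ideals generated on a segment *)

Section Segments.

Variables (K : fieldType) (p q g : nat).
Hypotheses (p_gt0 : 0 < p) (q_gt0 : 0 < q).
Implicit Types (A B : nat -> Prop) (k l : nat).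

Definition segment_monom k i := monom (p * i) (q * (k * g - i)).

Definition segment_set k A (m : 'X_{1..2}) :=
  exists i, [/\ A i, i <= k * g & m = segment_monom k i].

Definition segment_ideal k A := @monom_gen K (segment_set k A).

Definition sumset A B i := exists i1 i2, [/\ A i1, B i2 & i = i1 + i2].

Lemma segment_monom_le k i i' : i <= k * g -> i' <= k * g ->
  (segment_monom k i <= segment_monom k i')%MM -> i = i'.
Proof.
by rewrite /segment_monom monom_le !leq_pmul2l // => hi hi' /andP[]; lia.
Qed.

Lemma segment_set_antichain k A m1 m2 :
  segment_set k A m1 -> segment_set k A m2 -> (m1 <= m2)%MM -> m1 = m2.
Proof.
move=> [i [_ hi ->]] [i' [_ hi' ->]] le.
by rewrite (segment_monom_le hi hi' le).
Qed.

Lemma segment_ideal_eqE k A B :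
  ideal_eq (segment_ideal k A) (segment_ideal k B) <->
  forall i, i <= k * g -> A i <-> B i.
Proof.
split; last first.
  move=> h; apply: monom_gen_eq => m.
  by split=> -[i [hA hi ->]]; exists i; split=> //; apply/(h i hi).
have sub A' B' i : ideal_eq (segment_ideal k A') (segment_ideal k B') ->
    i <= k * g -> A' i -> B' i.
  move=> h hi hA; have /h/monom_genP[_ [i' [hB hi' ->]] le] :
    segment_ideal k A' 'X_[segment_monom k i]%R.
    by apply: monom_gen_sub; exists i.
  by rewrite -(segment_monom_le hi' hi le).
move=> h i hi; split; apply: sub => //; exact: ideal_eq_sym.
Qed.

Lemma segment_ideal_mul k l A B :
  (forall i, A i -> i <= k * g) -> (forall i, B i -> i <= l * g) ->
  ideal_eq (ideal_mul (segment_ideal k A) (segment_ideal l B))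
           (segment_ideal (k + l) (sumset A B)).
Proof.
have add i1 i2 : i1 <= k * g -> i2 <= l * g ->
    (segment_monom k i1 + segment_monom l i2)%MM = segment_monom (k + l) (i1 + i2).
  by move=> h1 h2; rewrite /segment_monom monomD -!mulnDr; congr (monom _ (q * _)); lia.
move=> hA hB; apply: ideal_eq_trans (monom_gen_mul _ _) _.
apply: monom_gen_eq => m; split.
  move=> [_ [_ [[i1 [A1 h1 ->]] [i2 [B2 h2 ->]] ->]]].
  exists (i1 + i2); split; last exact: add.
    by exists i1, i2.
  by rewrite mulnDl leq_add.
move=> [_ [[i1 [i2 [A1 B2 ->]]] _ ->]].
exists (segment_monom k i1), (segment_monom l i2); rewrite add; auto.
by split=> //; [exists i1|exists i2]; split; auto.
Qed.

Definition ends k i := i = 0 \/ i = k * g.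

Lemma corner_segment k :
  ideal_eq (@corner_ideal K (k * (p * g)) (k * (q * g))) (segment_ideal k (ends k)).
Proof.
have e0 : monom 0 (k * (q * g)) = segment_monom k 0.
  by rewrite /segment_monom subn0 muln0 mulnCA.
have e1 : monom (k * (p * g)) 0 = segment_monom k (k * g).
  by rewrite /segment_monom subnn muln0 mulnCA.
apply: monom_gen_eq => m; rewrite e0 e1; split.
  by case=> ->; [exists (k * g)|exists 0]; split=> //; [right|left].
by move=> [i [[]-> _ ->]]; [right|left].
Qed.

(** * The sumsets of the witness *)

Variable t : nat.
Hypotheses (t_gt1 : 1 < t) (t_ltg : t < g).

(** The [k]-fold sumset of [{0, 1} U [t, g]]; [s] counts the summands taken
    from [[t, g]]. *)
Definition witness k i :=
  exists s, [/\ s <= k, s * t <= i & i <= s * g + (k - s)].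

Lemma witness_bound k i : witness k i -> i <= k * g.
Proof.
move=> [s [hs _ hi]]; apply: leq_trans hi _.
by rewrite -{2}(subnKC hs) mulnDl leq_add2l leq_pmulr //; lia.
Qed.

(** Choosing [s1 + s2] summands in [[t, g]] splits as [s1] and [s2], and a sum
    of two intervals is the whole interval between the sums of their ends. *)
Lemma witnessD k l i : sumset (witness k) (witness l) i <-> witness (k + l) i.
Proof.
split.
  move=> [i1 [i2 [[s1 [? ? ?]] [s2 [? ? ?]] ->]]].
  by exists (s1 + s2); rewrite !mulnDl; split; lia.
move=> [s [hs lo hi]].
have [s1 [s2 [h1 h2 es]]] : exists s1 s2, [/\ s1 <= k, s2 <= l & s = s1 + s2].
  by exists (minn s k), (s - k); split; lia.
move: lo hi; rewrite es !mulnDl => lo hi.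
have le1 : s1 * t <= s1 * g by rewrite leq_mul2l ltnW ?orbT.
have le2 : s2 * t <= s2 * g by rewrite leq_mul2l ltnW ?orbT.
(* The first summand is as large as its interval and the lower end of the
   second interval allow. *)
pose i1 := minn (s1 * g + (k - s1)) (i - s2 * t).
by exists i1, (i - i1); split; [exists s1|exists s2|]; rewrite /i1; try split; lia.
Qed.

Lemma witness0 i : witness 0 i <-> i = 0.
Proof.
split=> [[s [hs _ hi]]|->]; last by exists 0; rewrite mul0n.
by move: hs hi; rewrite leqn0 => /eqP ->; lia.
Qed.

(** Consecutive intervals [s] and [s + 1] overlap or touch as soon as
    [t <= s * (g - 1 - t) + k + 1], which holds for all [s] when [t <= k + 1]. *)
Lemma full_sumset k i : t <= k.+1 -> witness k i <-> i <= k * g.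
Proof.
move=> tk; split=> [/witness_bound //|hi].
have [le|lt] := leqP (k * t) i; first by exists k; split; rewrite ?subnn ?addn0.
exists (i %/ t).
have sk : i %/ t < k by rewrite ltn_divLR ?(ltnW t_gt1) //; lia.
have hs : i %/ t * t <= i by rewrite leq_divM.
split=> //; first exact: ltnW.
have lt' : i < (i %/ t).+1 * t by rewrite ltn_ceil // ltnW.
have : (i %/ t * t.+1 <= i %/ t * g) by rewrite leq_mul2l t_ltg orbT.
by move: lt'; rewrite mulSn mulnS; lia.
Qed.

Lemma witness_gap k i : (k < i < t) -> ~ witness k i.
Proof.
move=> /andP[ki it] [[|s] [_ lo hi]]; first by lia.
by move: lo; rewrite mulSn; lia.
Qed.

Notation J k := (segment_ideal k (witness k)).

Lemma segment_exp k n : ideal_eq (ideal_exp (J k) n) (J (n * k)).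
Proof.
elim: n => [|n IH].
  apply: ideal_eq_sym; apply: ideal_eq_trans _ (@monom_gen1 K).
  have m0 : segment_monom 0 0 = 0%MM.
    apply/mnmP => i; rewrite /segment_monom mul0n !muln0 multinomE mnm0E (tnth_nth 0) /=.
    by case: i => [[|[]]].
  apply: monom_gen_eq => m; rewrite mul0n; split=> [[i [/witness0 -> _ ->]] //|->].
  by exists 0; split=> //; apply/witness0.
apply: ideal_eq_trans (ideal_mul_eq (fun u => iff_refl _) IH) _.
apply: ideal_eq_trans (segment_ideal_mul _ _) _; try exact: witness_bound.
by rewrite mulSn; apply/segment_ideal_eqE => i _; apply: witnessD.
Qed.

(** This turns the condition on [n] in the definition of [r(I ^ k)] into a
    statement about index sets. *)
Lemma reduction_step k n :
  ideal_eq (ideal_exp (ideal_exp (J 1) k) n.+1)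
    (ideal_mul (corner_ideal (k * (p * g)) (k * (q * g)))
               (ideal_exp (ideal_exp (J 1) k) n)) <->
  forall i, i <= n.+1 * k * g ->
    witness (n.+1 * k) i <-> sumset (ends k) (witness (n * k)) i.
Proof.
have powE l : ideal_eq (ideal_exp (ideal_exp (J 1) k) l) (J (l * k)).
  apply: ideal_eq_trans (segment_exp k l).
  by apply: ideal_exp_eq; have := segment_exp 1 k; rewrite muln1.
have mulE : ideal_eq
    (ideal_mul (corner_ideal (k * (p * g)) (k * (q * g)))
               (ideal_exp (ideal_exp (J 1) k) n))
    (segment_ideal (n.+1 * k) (sumset (ends k) (witness (n * k)))).
  apply: ideal_eq_trans (ideal_mul_eq (corner_segment k) (powE n)) _.
  rewrite mulSn; apply: segment_ideal_mul; last exact: witness_bound.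
  by move=> i [] ->.
rewrite -segment_ideal_eqE; split=> h.
  exact: ideal_eq_trans (ideal_eq_sym (powE _)) (ideal_eq_trans h mulE).
exact: ideal_eq_trans (powE _) (ideal_eq_trans h (ideal_eq_sym mulE)).
Qed.

Lemma witness_class1 : ideal_class1 (p * g) (q * g) (J 1).
Proof.
have minP m := min_monom_generator_antichain K m (@segment_set_antichain 1 (witness 1)).
split.
- by split; [exact: ideal_gen_ideal|exists (segment_set 1 (witness 1))].
- apply/minP; exists g; rewrite /segment_monom mul1n subnn muln0; split=> //.
  by exists 1; rewrite !mul1n subnn addn0 (ltnW t_ltg).
- apply/minP; exists 0; rewrite /segment_monom mul1n subn0 muln0; split=> //.
  by exists 0.
move=> c d /minP[i [_ hi e]]; move: hi; rewrite mul1n => hi.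
have [-> ->] : c = p * i /\ d = q * (g - i).
  have := congr1 (fun m : 'X_{1..2} => (m ord0, m ord_max)) e.
  by rewrite /segment_monom !multinomE !(tnth_nth 0) /= mul1n => -[].
by rewrite -{3}(subnKC hi); nia.
Qed.

Lemma witness_c_number : is_c_number (p * g) (q * g) (J 1) t.-1.
Proof.
have t1 : 0 < t.-1 by lia.
split; first split=> //; first split.
- apply/reduction_step => i; rewrite mul1n => hi.
  rewrite full_sumset; last by lia.
  split=> // _; have [le|lt] := leqP i (t.-1 * g).
    exists 0, i; split=> //; first by left.
    by rewrite full_sumset; lia.
  exists (t.-1 * g), (i - t.-1 * g); split; [by right| |by lia].
  by rewrite full_sumset; [move: hi; rewrite mul2n -addnn mulnDl|]; lia.
- (* The index [1] shows that the reduction number is not [0]. *)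
  case=> // /reduction_step /(_ 1); rewrite mul1n mul0n => h.
  have tg : 1 < t.-1 * g by nia.
  have /(h (ltnW tg))[i1 [i2 [h1 /witness0 -> e]]] : witness t.-1 1.
    by exists 0; split=> //; lia.
  by case: h1; lia.
move=> k [k1 [/reduction_step h _]]; rewrite leqNgt; apply/negP => kt.
(* Since [1 < t < g], the shift by [k * g] starts beyond [k + 1]. *)
have kg : 3 * k <= k * g by rewrite mulnC leq_mul2l; lia.
have k2 : k.+1 <= 2 * k * g by rewrite -mulnA; lia.
have /(h _ k2)[i1 [i2 [h1 h2 e]]] : witness (2 * k) k.+1.
  by exists 0; split=> //; lia.
move: h2; rewrite mul1n => h2.
by case: h1 => h1; [apply: (witness_gap _ h2)|]; lia.
Qed.

End Segments.

Theorem proposition7p4 (K : fieldType) (a b g j : nat)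
    (ha : (2 <= a)%N) (hab : (a <= b)%N) (hg : g = gcdn a b)
    (hj1 : (1 <= j)%N) (hj2 : (j <= g - 2)%N) :
  exists I : {mpoly K[2]} -> Prop, ideal_class1 a b I /\ is_c_number a b I j.
Proof.
have /dvdnP[p ea] : g %| a by rewrite hg dvdn_gcdl.
have /dvdnP[q eb] : g %| b by rewrite hg dvdn_gcdr.
have p0 : (0 < p)%N by case: p ea => //; lia.
have q0 : (0 < q)%N by case: q eb => //; lia.
have t1 : (1 < j.+1)%N by [].
have tg : (j.+1 < g)%N by lia.
rewrite ea eb; exists (segment_ideal p q g 1 (witness g j.+1 1)); split.
  exact: witness_class1.
exact: witness_c_number t1 tg.
Qed.
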